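(* Let $f:\mathbb{R}^n\to\mathbb{R}^n$ be a twice continuously differentiable vector field generating the flow $\Phi(t,x)$. Let $F:\mathbb{R}^n\to\mathbb{R}^{n-m}$ be continuously differentiable with Jacobian $F_x(p)$ of rank $n-m$ at every $p\in\mathcal{M}:=F^{-1}(\mathbf{0})$, so that $\mathcal{M}$ is an $m$-dimensional embedded submanifold of $\mathbb{R}^n$, and assume that $\mathcal{M}$ is invariant with respect to $\dot x=f(x)$. Let $\Omega\subset\mathbb{R}^n$ be a compact set such that $\mathcal{M}\cap\Omega$ is compact and non-empty, and assume that $$\Gamma(p)=F_x(p)\bigl(f_x(p)+f_x(p)^T\bigr)F_x(p)^T$$ is positive definite for every $p\in\mathcal{M}\cap\Omega$. Assume additionally that $\Omega$ is invariant and is a strict superset of $\mathcal{M}\cap\Omega$. Then there exists $\epsilon^*>0$ such that for every $\epsilon\in(0,\epsilon^*]$ the tubular $\epsilon$ neighbourhood $\mathcal{M}_\epsilon$ is overflowing invariant in $\Omega$ and the set $\Omega\setminus\bar{\mathcal{M}}_\epsilon$ is invariant.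
   Context: Here $f_x(p)$ and $F_x(p)$ denote the Jacobians of $f$ and $F$ at $x=p$. A set $A$ is invariant with respect to $\dot x=f(x)$ if $x_0\in A$ implies $\Phi(t,x_0)\in A$ for all $t\ge 0$. For $p\in\mathcal{M}$, $N_p\mathcal{M}$ is the normal space of $\mathcal{M}$ at $p$ (the orthogonal complement of the tangent space $T_p\mathcal{M}$ in $\mathbb{R}^n$ with the Euclidean inner product). The tubular $\epsilon$ neighbourhood of $\mathcal{M}$ is $\mathcal{M}_\epsilon=\{p+\bar\epsilon\, n_p : p\in\mathcal{M},\ n_p\in N_p\mathcal{M},\ \|n_p\|=1,\ \bar\epsilon\in(0,\epsilon)\}$, its boundary is $\partial\mathcal{M}_\epsilon=\{p+\epsilon n_p : p\in\mathcal{M},\ n_p\in N_p\mathcal{M},\ \|n_p\|=1\}$, and $\bar{\mathcal{M}}_\epsilon:=\mathcal{M}\cup\mathcal{M}_\epsilon\cup\partial\mathcal{M}_\epsilon$. For $\epsilon>0$ and a set $\Omega$ with $\mathcal{M}\cap\Omega\neq\emptyset$, $\mathcal{M}_\epsilon$ is called overflowing invariant in $\Omega$ if for every $p\in\mathcal{M}\cap\Omega$ and every $n_p\in N_p\mathcal{M}$ with $\|n_p\|=1$ one has $\langle f(p+\epsilon n_p),n_p\rangle>0$. *)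

(* Defs.v *)
From HB Require Import structures.
From mathcomp Require Import all_boot all_order all_algebra.
From mathcomp Require Import all_classical all_reals all_analysis.

Set Implicit Arguments.
Unset Strict Implicit.
Unset Printing Implicit Defensive.

Import Order.TTheory GRing.Theory Num.Theory.
Import numFieldNormedType.Exports.

Local Open Scope classical_set_scope.
Local Open Scope ring_scope.

(* Points of R^n are row vectors.  The library norm on 'rV[R]_n is the sup    *)
(* norm, hence the separate Euclidean norm below.                             *)
Definition dotv (R : realType) n (u v : 'rV[R]_n) : R := (u *m v^T) 0 0.

Definition enorm (R : realType) n (u : 'rV[R]_n) : R := Num.sqrt (dotv u u).

Definition posdefmx (R : realType) n (A : 'M[R]_n) : Prop :=
  A^T = A /\ forall v : 'rV[R]_n, v != 0 -> 0 < (v *m A *m v^T) 0 0.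

(* The library's 'J g p acts on row vectors from the right, so it is the      *)
(* transpose of the usual matrix of partial derivatives (dg_i / dx_j)_(i,j).  *)
Definition Jac (R : realType) n k (g : 'rV[R]_n -> 'rV[R]_k) (p : 'rV[R]_n) :
  'M[R]_(k, n) := ('J g p)^T.

Definition C1 (R : realType) n k (g : 'rV[R]_n -> 'rV[R]_k) : Prop :=
  (forall x, differentiable g x) /\ continuous (fun x => Jac g x).

Definition C2 (R : realType) n k (g : 'rV[R]_n -> 'rV[R]_k) : Prop :=
  (forall x, differentiable g x) /\ C1 (fun x => mxvec (Jac g x)).

Definition solution (R : realType) n (f : 'rV[R]_n -> 'rV[R]_n)
    (I : set R) (gamma : R -> 'rV[R]_n) : Prop :=
  forall t, I t -> is_derive t 1 gamma (f (gamma t)).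

(* Phi is the maximal flow of f: the solution with initial value x lives on   *)
(* the maximal open interval D x.  A complete flow is the case D x = setT;    *)
(* outside D x the value of Phi is irrelevant.                                *)
Record flow_of (R : realType) n (f : 'rV[R]_n -> 'rV[R]_n)
    (D : 'rV[R]_n -> set R) (Phi : R -> 'rV[R]_n -> 'rV[R]_n) : Prop := FlowOf {
  flow_dom : forall x, [/\ open (D x), is_interval (D x) & D x 0];
  flow_init : forall x, Phi 0 x = x;
  flow_sol : forall x, solution f (D x) (fun t => Phi t x);
  flow_max : forall x (I : set R) (gamma : R -> 'rV[R]_n),
    open I -> is_interval I -> I 0 -> gamma 0 = x -> solution f I gamma ->
    I `<=` D x }.

(* "Phi t x lies in A for all t >= 0" includes that Phi t x is defined.       *)
Definition invariant_set (R : realType) n (D : 'rV[R]_n -> set R)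
    (Phi : R -> 'rV[R]_n -> 'rV[R]_n) (A : set 'rV[R]_n) : Prop :=
  forall x, A x -> forall t, 0 <= t -> D x t /\ A (Phi t x).

(* Velocities at p of curves in M through p. *)
Definition tangent_space (R : realType) n (M : set 'rV[R]_n) (p : 'rV[R]_n) :
    set 'rV[R]_n :=
  [set v | exists gamma : R -> 'rV[R]_n,
    [/\ gamma 0 = p, \forall t \near (0 : R), M (gamma t) &
        is_derive (0 : R) 1 gamma v]].

Definition normal_space (R : realType) n (M : set 'rV[R]_n) (p : 'rV[R]_n) :
    set 'rV[R]_n :=
  [set u | forall v, tangent_space M p v -> dotv u v = 0].

Definition unit_normal (R : realType) n (M : set 'rV[R]_n) (p : 'rV[R]_n) :
    set 'rV[R]_n :=
  [set u | normal_space M p u /\ enorm u = 1].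

Definition tube (R : realType) n (M : set 'rV[R]_n) (eps : R) :
    set 'rV[R]_n :=
  [set x | exists p u e, [/\ M p, unit_normal M p u, 0 < e < eps &
                             x = p + e *: u]].

Definition tube_boundary (R : realType) n (M : set 'rV[R]_n) (eps : R) :
    set 'rV[R]_n :=
  [set x | exists p u, [/\ M p, unit_normal M p u & x = p + eps *: u]].

Definition closed_tube (R : realType) n (M : set 'rV[R]_n) (eps : R) :
    set 'rV[R]_n :=
  M `|` tube M eps `|` tube_boundary M eps.

(* Meant for 0 < eps and M `&` Omega !=set0. *)
Definition tube_overflowing (R : realType) n (f : 'rV[R]_n -> 'rV[R]_n)
    (M : set 'rV[R]_n) (eps : R) (Omega : set 'rV[R]_n) : Prop :=
  forall p u, (M `&` Omega) p -> unit_normal M p u ->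
    0 < dotv (f (p + eps *: u)) u.

Definition Gamma (R : realType) n k (f : 'rV[R]_n -> 'rV[R]_n)
    (F : 'rV[R]_n -> 'rV[R]_k) (p : 'rV[R]_n) : 'M[R]_k :=
  Jac F p *m (Jac f p + (Jac f p)^T) *m (Jac F p)^T.

(* Main.v *)
(** Invariance of [M] makes [f p] tangent to [M], so [<f (p + s u), u>] vanishes
    at [s = 0] for [u] normal at [p], and its derivative there is
    [u f_x(p) u^T].  Normal vectors have the form [u = w F_x(p)], which turns
    that derivative into [w Gamma(p) w^T / 2 > 0]; positivity persists for small
    [s], uniformly by compactness.  That normal vectors have this form needs
    every [v] with [F_x(p) v = 0] to be a velocity of [M] at [p]: the points
    [p + t v] are corrected by [o(t)] to lie in [M].

    The closed tube is the set of points at distance at most [eps] from [M], as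
    nearest-point segments are normal to [M].  If an orbit in [Omega] entered
    it, then at the entrance time its velocity would point away from the nearest
    point of [M], although the distance to that point cannot be increasing. *)

Require Import Defs.
From HB Require Import structures.
From mathcomp Require Import all_boot all_order all_algebra.
From mathcomp Require Import all_classical all_reals all_analysis.
From mathcomp Require Import ring lra.

Set Implicit Arguments.
Unset Strict Implicit.
Unset Printing Implicit Defensive.

Import Order.TTheory GRing.Theory Num.Theory.
Import numFieldNormedType.Exports.

Local Open Scope classical_set_scope.
Local Open Scope ring_scope.

(** * Matrix norm and Euclidean inner product *)

Lemma mx_norm_le (R : realType) m n (A : 'M[R]_(m, n)) (c : R) :
  0 <= c -> (forall i j, `|A i j| <= c) -> `|A| <= c.
Proof.
move=> c0 Ac; rewrite [leLHS]/Num.norm /= mx_normrE; apply/bigmax_leP.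
by split => // -[i j] _; exact: Ac.
Qed.

Lemma coord_le_norm (R : realType) m n (A : 'M[R]_(m, n)) i j :
  `|A i j| <= `|A|.
Proof.
rewrite [leRHS]/Num.norm /= mx_normrE.
by apply/bigmax_geP; right => /=; exists (i, j).
Qed.

Lemma norm_mulmx_le (R : realType) m n k (A : 'M[R]_(m, n)) (B : 'M[R]_(n, k)) :
  `|A *m B| <= n%:R * `|A| * `|B|.
Proof.
apply: mx_norm_le => [|i j]; first by rewrite !mulr_ge0.
rewrite mxE (le_trans (ler_norm_sum _ _ _))//.
rewrite (le_trans (y := \sum_(l < n) (`|A| * `|B|)))//.
  by apply: ler_sum => l _; rewrite normrM ler_pM// coord_le_norm.
by rewrite sumr_const card_ord -mulrA mulr_natl.
Qed.

Lemma cvg_mx (R : realType) T (F : set_system T) {FF : Filter F} m n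
    (f : T -> 'M[R]_(m, n)) (A : 'M[R]_(m, n)) :
  (forall i j, f x i j @[x --> F] --> A i j) -> f @ F --> A.
Proof.
move=> fA; apply/cvgrPdist_lt => e e0.
have : \forall x \near F, forall i j, `|A i j - f x i j| < e / 2.
  apply: filter_forall => i; apply: filter_forall => j.
  by have /cvgrPdist_lt := fA i j; apply; rewrite divr_gt0.
apply: filterS => x Ax; apply: (@le_lt_trans _ _ (e / 2)); last lra.
by apply: mx_norm_le => [|i j]; [lra|rewrite !mxE ltW].
Qed.

Lemma cvg_coord (R : realType) T (F : set_system T) {FF : Filter F} m n
    (f : T -> 'M[R]_(m, n)) (A : 'M[R]_(m, n)) i j :
  f @ F --> A -> f x i j @[x --> F] --> A i j.
Proof.
move=> fA.
exact: (cvg_comp f (fun M : 'M[R]_(m, n) => M i j) fA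
  (@coord_continuous R m n i j A)).
Qed.

Lemma cvg_trmx (R : realType) T (F : set_system T) {FF : Filter F} m n
    (f : T -> 'M[R]_(m, n)) (A : 'M[R]_(m, n)) :
  f @ F --> A -> (f x)^T @[x --> F] --> A^T.
Proof.
move=> fA; apply: cvg_mx => i j; rewrite mxE.
by under eq_cvg do rewrite mxE; exact: cvg_coord.
Qed.

Lemma cvg_mulmx (R : realType) T (F : set_system T) {FF : Filter F} m n k
    (f : T -> 'M[R]_(m, n)) (g : T -> 'M[R]_(n, k))
    (A : 'M[R]_(m, n)) (B : 'M[R]_(n, k)) :
  f @ F --> A -> g @ F --> B -> f x *m g x @[x --> F] --> A *m B.
Proof.
move=> fA gB; apply: cvg_mx => i j; rewrite mxE.
under eq_cvg do rewrite mxE.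
apply: cvg_big => [|l _]; first exact: add_continuous.
by apply: cvgM; exact: cvg_coord.
Qed.

Lemma cvg_dotv (R : realType) T (F : set_system T) {FF : Filter F} n
    (f g : T -> 'rV[R]_n) (a b : 'rV[R]_n) :
  f @ F --> a -> g @ F --> b -> dotv (f x) (g x) @[x --> F] --> dotv a b.
Proof.
by move=> fa gb; apply: cvg_coord; apply: cvg_mulmx => //; exact: cvg_trmx.
Qed.

Lemma dotvDl (R : realType) n (u v w : 'rV[R]_n) :
  dotv (u + v) w = dotv u w + dotv v w.
Proof. by rewrite /dotv mulmxDl mxE. Qed.

Lemma dotvC (R : realType) n (u v : 'rV[R]_n) : dotv u v = dotv v u.
Proof.
by rewrite /dotv !mxE; apply: eq_bigr => i _; rewrite !mxE mulrC.
Qed.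

Lemma dotvZl (R : realType) n a (u v : 'rV[R]_n) :
  dotv (a *: u) v = a * dotv u v.
Proof. by rewrite /dotv -scalemxAl mxE. Qed.

Lemma dotvZr (R : realType) n a (u v : 'rV[R]_n) :
  dotv u (a *: v) = a * dotv u v.
Proof. by rewrite dotvC dotvZl dotvC. Qed.

Lemma dotvNl (R : realType) n (u v : 'rV[R]_n) : dotv (- u) v = - dotv u v.
Proof. by rewrite -scaleN1r dotvZl mulN1r. Qed.

Lemma dotvE (R : realType) n (u v : 'rV[R]_n) :
  dotv u v = \sum_(i < n) u 0 i * v 0 i.
Proof. by rewrite /dotv mxE; apply: eq_bigr => i _; rewrite mxE. Qed.

Lemma dotvv_ge0 (R : realType) n (u : 'rV[R]_n) : 0 <= dotv u u.
Proof. by rewrite dotvE sumr_ge0// => i _; rewrite -expr2 sqr_ge0. Qed.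

(** The square of the largest coordinate is one of the summands. This links the sup norm, which
    carries the topology, to Euclidean length. *)
Lemma sqr_norm_le_dotv (R : realType) n (u : 'rV[R]_n) : `|u| ^+ 2 <= dotv u u.
Proof.
have [->|u0] := eqVneq u 0; first by rewrite normr0 expr0n dotvv_ge0.
have [[i j] /= uij] : exists i, `|u| = `|u i.1 i.2|.
  by apply: mx_norm_neq0; rewrite -[mx_norm u]/(`|u|) normr_eq0.
rewrite uij (ord1 i) dotvE (bigD1 j)//= real_normK ?num_real// expr2.
by rewrite lerDl sumr_ge0// => l _; rewrite -expr2 sqr_ge0.
Qed.

Lemma dotvv_eq0 (R : realType) n (u : 'rV[R]_n) : (dotv u u == 0) = (u == 0).
Proof.
apply/eqP/eqP => [u0|->]; last by rewrite /dotv mul0mx mxE.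
apply/eqP; rewrite -normr_eq0 -sqrf_eq0 eq_le sqr_ge0 andbT -u0.
exact: sqr_norm_le_dotv.
Qed.

Lemma dotvv_gt0 (R : realType) n (u : 'rV[R]_n) : (0 < dotv u u) = (u != 0).
Proof. by rewrite lt_def dotvv_ge0 andbT dotvv_eq0. Qed.

Lemma enorm1E (R : realType) n (u : 'rV[R]_n) : enorm u = 1 -> dotv u u = 1.
Proof.
by move=> u1; rewrite -(sqr_sqrtr (dotvv_ge0 u)) -/(enorm u) u1 expr1n.
Qed.

Lemma norm_trmx (R : realType) m n (A : 'M[R]_(m, n)) : `|A^T| = `|A|.
Proof.
have le p q (B : 'M[R]_(p, q)) : `|B^T| <= `|B|.
  by apply: mx_norm_le => // i j; rewrite mxE coord_le_norm.
by apply/eqP; rewrite eq_le le -{1}(trmxK A) le.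
Qed.

(** * Derivatives along curves and local solvability *)

Lemma is_derive_quotP (R : realType) (V : normedModType R) (g : R -> V)
    (t : R) (d : V) :
  is_derive t 1 g d <-> h^-1 *: (g (t + h) - g t) @[h --> (0 : R)^'] --> d.
Proof.
have E : (fun h : R => h^-1 *: ((g \o shift t) (h *: (1 : R)) - g t)) =
         (fun h => h^-1 *: (g (t + h) - g t)).
  by apply/funext => h /=; rewrite [h *: _]mulr1 (addrC h).
rewrite -E; split=> [[gd <-]//|gd]; split; first by apply/cvg_ex; exists d.
exact/cvg_lim.
Qed.

Lemma is_derive_quot_right (R : realType) (V : normedModType R) (g : R -> V)
    (t : R) (d : V) :
  is_derive t 1 g d -> h^-1 *: (g (t + h) - g t) @[h --> (0 : R)^'+] --> d.
Proof. by move=> /is_derive_quotP/cvg_dnbhs_at_right. Qed.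

Lemma is_derive_gt0_left (R : realType) (g : R -> R) (t d : R) :
  is_derive t 1 g d -> 0 < d -> \forall h \near (0 : R)^'-, g (t + h) < g t.
Proof.
move=> /is_derive_quotP/cvg_dnbhs_at_left gd d0; near=> h.
have h0 : h < 0 by near: h; exact: nbhs_left_lt.
have : 0 < h^-1 * (g (t + h) - g t) by near: h; exact: (cvgr_gt d).
by rewrite nmulr_rgt0 ?invr_lt0// subr_lt0.
Unshelve. all: by end_near. Qed.

Lemma is_derive_min (R : realType) (g : R -> R) (t d : R) :
  is_derive t 1 g d ->
  (\forall h \near (0 : R), g t <= g (t + h)) -> d = 0.
Proof.
move=> gd gmin; apply/eqP; rewrite eq_le; apply/andP; split.
  rewrite leNgt; apply/negP => /(is_derive_gt0_left gd) glt.
  have [h /= [? ?]] : exists h, g t <= g (t + h) /\ g (t + h) < g t.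
    apply: (@filter_ex _ (0 : R)^'-); apply: filterI => //.
    by apply: cvg_at_left_filter gmin; exact: cvg_id.
  lra.
rewrite leNgt; apply/negP => d0.
have /cvgr_lt/(_ _ d0) glt := is_derive_quot_right gd.
have [h /= [[? glt0] h0]] : exists h, (g t <= g (t + h) /\
    h^-1 * (g (t + h) - g t) < 0) /\ 0 < h.
  apply: (@filter_ex _ (0 : R)^'+); apply: filterI; last exact: nbhs_right_gt.
  by apply: filterI => //; apply: cvg_at_right_filter gmin; exact: cvg_id.
by move: glt0; rewrite pmulr_rlt0 ?invr_gt0// subr_lt0 ltNge => /negP.
Qed.

Lemma is_derive_coord (R : realType) (m n : nat) (M : R -> 'M[R]_(m, n))
    (t : R) (d : 'M[R]_(m, n)) i j :
  is_derive t 1 M d -> is_derive t 1 (fun x => M x i j) (d i j).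
Proof.
move=> [Md <-]; have /derivable_mxP/(_ i j) Mij := Md.
by split => //; rewrite derive_mx// mxE.
Qed.

Lemma is_derive_curve (R : realType) n k (g : 'rV[R]_n -> 'rV[R]_k)
    (c : R -> 'rV[R]_n) (t : R) (v : 'rV[R]_n) :
  differentiable g (c t) -> is_derive t 1 c v ->
  is_derive t 1 (g \o c) (v *m 'J g (c t)).
Proof.
move=> dg [cd <-]; have dc : differentiable c t by exact/derivable1_diffP.
have dgc : differentiable (g \o c) t by exact: differentiable_comp.
split; first exact: diff_derivable.
by rewrite !deriveE// diff_comp//= /jacobian mul_rV_lin1.
Qed.

Lemma is_derive_line (R : realType) (V : normedModType R) (x v : V) (s : R) :
  is_derive s 1 (fun s => x + s *: v) v.
Proof.
apply/is_derive_quotP.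
have : v @[_ --> (0 : R)^'] --> v by exact: cvg_cst.
apply: cvg_trans; apply: near_eq_cvg; near=> h.
have h0 : h != 0 by near: h; exact: nbhs_dnbhs_neq.
by rewrite opprD addrACA subrr add0r -scalerBl addrAC subrr add0r scalerA
  mulVf// scale1r.
Unshelve. all: by end_near. Qed.

(** Strict differentiability: the mean value theorem is applied to each coordinate along the segment
    from [y] to [x], which stays in a ball around [p] where the Jacobian is nearly ['J g p]. *)
Lemma C1_strict (R : realType) n k (g : 'rV[R]_n -> 'rV[R]_k) p (eta : R) :
  C1 g -> 0 < eta ->
  exists2 delta : R, 0 < delta & forall x y, `|x - p| < delta ->
    `|y - p| < delta -> `|g x - g y - (x - y) *m 'J g p| <= eta * `|x - y|.
Proof.
move=> [dg cg] eta0.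
(* The division absorbs the factor [n] of [norm_mulmx_le]; the successor covers [n = 0]. *)
have eta1 : 0 < eta / n.+1%:R by rewrite divr_gt0.
have /cvgrPdist_lt/(_ _ eta1) := cg p.
move=> /nbhs_ballP[d /= d0 pd].
exists d => // x y xd yd.
apply: mx_norm_le => [|l i]; first by rewrite mulr_ge0// ltW.
rewrite {l}(ord1 l).
pose phi (s : R) := g (y + s *: (x - y)) 0 i - s * ((x - y) *m 'J g p) 0 i.
pose dphi (s : R) := ((x - y) *m 'J g (y + s *: (x - y))) 0 i
  - ((x - y) *m 'J g p) 0 i.
have phid (s : R) : is_derive s 1 phi (dphi s).
  apply: is_deriveB; first exact/is_derive_coord/is_derive_curve/is_derive_line.
  have := is_derive_line (0 : R) (((x - y) *m 'J g p) 0 i : R) s.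
  by congr (is_derive _ _ _ _); apply/funext => r; rewrite add0r.
have [|c c01] := @MVT R phi dphi 0 1 ltr01 (fun s _ => phid s).
  apply: continuous_subspaceT => s; apply/differentiable_continuous.
  by apply/derivable1_diffP; case: (phid s).
rewrite /phi/dphi scale1r scale0r addr0 mul0r subr0 mul1r (addrC y)
  subrK subr0 mulr1.
move=> E.
have -> : (g x - g y - (x - y) *m 'J g p) 0 i =
    ((x - y) *m ('J g (y + c *: (x - y)) - 'J g p)) 0 i.
  have subE (u v : 'rV[R]_k) : (u - v) 0 i = u 0 i - v 0 i by rewrite !mxE.
  by rewrite mulmxBr !subE -E; ring.
rewrite (le_trans (coord_le_norm _ _ _))// (le_trans (norm_mulmx_le _ _))//.
set z := y + _.
have /pd : ball p d z.
  rewrite -ball_normE /= /z distrC.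
  have -> : y + c *: (x - y) - p = (1 - c) *: (y - p) + c *: (x - p).
    by apply/rowP => l; rewrite !mxE; ring.
  move: c01; rewrite in_itv/= => /andP[c0 c1].
  rewrite (le_lt_trans (ler_normD _ _))// !normrZ !gtr0_norm ?subr_gt0//.
  have h1 : (1 - c) * `|y - p| < (1 - c) * d by rewrite ltr_pM2l ?subr_gt0.
  have h2 : c * `|x - p| < c * d by rewrite ltr_pM2l.
  by rewrite (lt_le_trans (ltrD h1 h2))// -mulrDl subrK mul1r.
rewrite /= /Jac => Jlt.
rewrite -linearB/= norm_trmx distrC in Jlt.
rewrite mulrAC ler_wpM2r//.
have := ltW Jlt; rewrite ler_pdivlMr// mulrC => /(le_trans _); apply.
by rewrite ler_wpM2r// ler_nat.
Qed.

(* The approximate solution [w] minimizes [|F(x + wB)| + |w|/4]: a Newton step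
   from [w] would halve the residual, hence the residual vanishes. *)
Lemma C1_local_solve (R : realType) n k (F : 'rV[R]_n -> 'rV[R]_k) p
    (B : 'M[R]_(k, n)) :
  C1 F -> B *m 'J F p = 1%:M ->
  exists2 delta : R, 0 < delta & forall x, `|x - p| < delta ->
    `|F x| < delta -> exists w, F (x + w *m B) = 0 /\ `|w| <= 4 * `|F x|.
Proof.
move=> CF BJ; set b : R := k%:R * `|B| + 1.
have b0 : 0 < b by rewrite ltr_wpDl// mulr_ge0.
have Bb (w : 'rV[R]_k) : `|w *m B| <= b * `|w|.
  rewrite (le_trans (norm_mulmx_le _ _))// mulrAC ler_wpM2r//.
  by rewrite /b lerDl.
(* With this accuracy the linearization error of a Newton step [r *m B] is at most half of [|r|]. *)
have eta0 : 0 < (2 * b)^-1 by rewrite invr_gt0 mulr_gt0.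
have [d d0 strict] := C1_strict p CF eta0.
(* The solution of [delta + b * (5 * delta) = d], which keeps [x + w *m B] within [d] of [p]
   whenever [|w| <= 5 * |F x|]. *)
pose delta := d / (1 + 5 * b).
have b5 : 0 < 1 + 5 * b by lra.
have delta0 : 0 < delta by rewrite divr_gt0.
have deltaE : delta + b * (5 * delta) = d.
  by rewrite -[RHS](divfK (lt0r_neq0 b5) d) -/delta; ring.
exists delta => // x xp Fx.
have nearp (w : 'rV[R]_k) : `|w| <= 5 * `|F x| -> `|x + w *m B - p| < d.
  move=> w5; rewrite addrAC (le_lt_trans (ler_normD _ _))// -deltaE.
  apply: ltr_leD => //; rewrite (le_trans (Bb w))// ler_pM2l//.
  by rewrite (le_trans w5)// ler_pM2l// ltW.
(* Comparison with [w = 0] bounds the minimizer and its residual [r] by [|w| + |r| <= 4 * |F x|], so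
   the Newton step from it still lies in [K]. *)
pose K := [set w : 'rV[R]_k | `|w| <= 5 * `|F x|].
pose val (w : 'rV[R]_k) := `|F (x + w *m B)| + `|w| / 4.
have cvgval T (G : set_system T) (FG : Filter G) (u : T -> 'rV[R]_k) w :
    u @ G --> w -> val (u t) @[t --> G] --> val w.
  move=> uw; have cxw : x + u t *m B @[t --> G] --> x + w *m B.
    by apply: cvgD; [exact: cvg_cst|apply: cvg_mulmx => //; exact: cvg_cst].
  apply: cvgD; last by apply: cvgMr_tmp; exact: cvg_norm.
  apply: cvg_norm.
  exact: (cvg_comp _ F cxw (differentiable_continuous (CF.1 _))).
have cval : continuous val.
  by move=> w; exact: (cvgval _ (nbhs w) _ id w cvg_id).
have K0 : K 0 by rewrite /K/= normr0 mulr_ge0.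
have cK : compact K.
  apply: bounded_closed_compact.
    exists (5 * `|F x|); split; [exact: num_real|].
    by move=> M /ltW ltM w Kw; exact: le_trans ltM.
  apply: (@closed_comp _ _ (fun w : 'rV[R]_k => `|w|)
    [set r : R | r <= 5 * `|F x|]).
    by move=> w _; exact: norm_continuous.
  exact: closed_le.
have [|w] := @EVT_min_rV R k val K _ cK (continuous_subspaceT cval).
  by exists 0.
rewrite inE => Kw wmin; exists w.
have w4 : `|F (x + w *m B)| + `|w| / 4 <= `|F x|.
  have := wmin 0 (mem_set K0).
  by rewrite /val mul0mx addr0 normr0 mul0r addr0.
set r := F (x + w *m B) in w4 *.
have r0 := normr_ge0 r; have w0 := normr_ge0 w.
split; last by lra.
pose w' := w - r.
have Kw' : K w'.
  by rewrite /K/= (le_trans (ler_normB _ _))//; lra.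
have := wmin w' (mem_set Kw'); rewrite /val -/r => wmin'.
have := strict _ _ (nearp _ Kw') (nearp _ Kw); rewrite -/r.
have -> : x + w' *m B - (x + w *m B) = - (r *m B).
  by rewrite opprD addrACA subrr add0r -mulmxBl /w' addrAC subrr add0r mulNmx.
rewrite mulNmx -mulmxA BJ mulmx1 opprK subrK normrN => half.
have half' : `|F (x + w' *m B)| <= `|r| / 2.
  rewrite (le_trans half)// (le_trans (y := (2 * b)^-1 * (b * `|r|)))//.
    by rewrite ler_pM2l.
  by rewrite mulrA invfM -(mulrA _ b^-1) mulVf ?lt0r_neq0// mulr1 mulrC.
have := ler_normB w r; rewrite -/w' => w'le.
(* Minimality gives [|r| + |w| / 4 <= |r| / 2 + (|w| + |r|) / 4], which forces [r = 0]. *)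
by apply/eqP; rewrite -normr_le0; lra.
Qed.

(** * Tangent and normal spaces of a level set *)

(** Since [v] is in the kernel, [F] is o(t) along the line [p + t v]. The correction back to the
    level set is at most four times that residual, so it leaves the velocity at 0 unchanged. *)
Lemma tangent_space_ker (R : realType) n k (F : 'rV[R]_n -> 'rV[R]_k)
    (p v : 'rV[R]_n) :
  C1 F -> \rank (Jac F p) = k -> F p = 0 -> v *m 'J F p = 0 ->
  tangent_space (F @^-1` [set 0]) p v.
Proof.
move=> CF rk Fp vJ; pose B := pinvmx ('J F p).
have BJ : B *m 'J F p = 1%:M.
  by rewrite mulVpmx// /row_full -mxrank_tr -/(Jac F p) rk.
have [delta delta0 solve] := C1_local_solve CF BJ.
pose x (t : R) := p + t *: v.
have x0 : x 0 = p by rewrite /x scale0r addr0.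
have x_near : \forall t \near (0 : R), `|x t - p| < delta /\ `|F (x t)| < delta.
  have xp : x t @[t --> (0 : R)] --> p.
    rewrite -x0; apply/differentiable_continuous/derivable1_diffP.
    by case: (is_derive_line p v 0).
  have Fx : F (x t) @[t --> (0 : R)] --> (0 : 'rV[R]_k).
    rewrite -Fp.
    exact: (cvg_comp _ F xp (differentiable_continuous (CF.1 _))).
  near=> t; split.
    rewrite distrC; near: t.
    by have /cvgrPdist_lt := xp; apply.
  by near: t; have /cvgr0Pnorm_lt := Fx; apply.
(* The corrections are chosen separately for each [t], with default 0 away from [t = 0]; the bound
   alone gives differentiability at 0. *)
have /choice[w wP] : forall t, exists w : 'rV[R]_k,
    `|x t - p| < delta /\ `|F (x t)| < delta ->
    F (x t + w *m B) = 0 /\ `|w| <= 4 * `|F (x t)|.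
  move=> t.
  have [[h1 h2]|h] := pselect (`|x t - p| < delta /\ `|F (x t)| < delta).
    by have [w wt] := solve _ h1 h2; exists w.
  by exists 0.
have w0 : w 0 = 0.
  have [_] := wP 0 (nbhs_singleton x_near).
  by rewrite x0 Fp normr0 mulr0 normr_le0 => /eqP.
exists (fun t => x t + w t *m B); split.
- by rewrite w0 mul0mx addr0.
- by near=> t; apply: (wP t _).1; near: t.
have dx : is_derive (0 : R) 1 x v by exact: is_derive_line.
rewrite -[v]addr0; apply: is_deriveD.
apply/is_derive_quotP.
under eq_cvg do rewrite add0r w0 mul0mx subr0 scalemxAl.
suff : (h^-1 *: w h) *m B @[h --> (0 : R)^'] --> (0 : 'rV[R]_k) *m B.
  by rewrite mul0mx.
apply: cvg_mulmx; last exact: cvg_cst.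
have quot : h^-1 *: F (x h) @[h --> (0 : R)^'] --> (0 : 'rV[R]_k).
  have := is_derive_curve (CF.1 (x 0)) dx => /is_derive_quotP.
  by rewrite /= x0 vJ Fp; under eq_cvg do rewrite add0r subr0.
apply/cvgr0Pnorm_lt => e e0.
have e4 : 0 < e / 4 by rewrite divr_gt0.
near=> h.
have [_ wh] : F (x h + w h *m B) = 0 /\ `|w h| <= 4 * `|F (x h)|.
  by apply: wP; near: h; exact: nbhs_dnbhs.
have : `|h^-1 *: F (x h)| < e / 4 by near: h; move/cvgr0Pnorm_lt: quot; apply.
rewrite ltr_pdivlMr// => /(le_lt_trans _); apply.
by rewrite !normrZ -mulrA ler_wpM2l// mulrC.
Unshelve. all: by end_near. Qed.

(** The transposed columns of the cokernel matrix of [Jac F p] are tangent by [tangent_space_ker]. A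
    normal [u] annihilates them all, which is the criterion for lying in the row space. *)
Lemma normal_space_rows (R : realType) n k (F : 'rV[R]_n -> 'rV[R]_k)
    (p u : 'rV[R]_n) :
  C1 F -> \rank (Jac F p) = k -> F p = 0 ->
  Defs.normal_space (F @^-1` [set 0]) p u -> exists w, u = w *m Jac F p.
Proof.
move=> CF rk Fp nu; apply/submxP; rewrite submxE; apply/eqP/rowP => j.
set K := cokermx _.
have : dotv u (col j K)^T = 0.
  apply: nu; apply: tangent_space_ker => //.
  rewrite -[X in _ *m X]trmxK -trmx_mul colE mulmxA.
  by rewrite (mulmx_coker (Jac F p)) mul0mx trmx0.
by rewrite /dotv trmxK colE mulmxA -colE mxE => ->; rewrite mxE.
Qed.

(** * Outward velocity near the level set *)

Lemma is_derive_dotv (R : realType) n (c : R -> 'rV[R]_n) (t : R)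
    (d u : 'rV[R]_n) :
  is_derive t 1 c d -> is_derive t 1 (fun r => dotv (c r) u) (dotv d u).
Proof.
move=> /is_derive_quotP cd; apply/is_derive_quotP.
under eq_cvg do rewrite -dotvNl -dotvDl -[_ *: _]/(_ * _) -dotvZl.
by apply: cvg_dotv => //; exact: cvg_cst.
Qed.

Lemma cvg_shift0 (R : realType) (t : R) : t + h @[h --> (0 : R)] --> t.
Proof.
rewrite -[X in _ --> X]addr0.
by apply: (@cvgD _ _ _ _ (nbhs_filter (0 : R))); [exact: cvg_cst|exact: cvg_id].
Qed.

Lemma is_derive_sqdist (R : realType) n (c : R -> 'rV[R]_n) (t : R)
    (d p : 'rV[R]_n) :
  is_derive t 1 c d ->
  is_derive t 1 (fun r => dotv (c r - p) (c r - p)) (2 * dotv d (c t - p)).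
Proof.
move=> cd; have ct : c (t + h) @[h --> (0 : R)^'] --> c t.
  have cc : c r @[r --> t] --> c t.
    apply/differentiable_continuous/derivable1_diffP.
    by case: cd.
  by move=> A /cc/cvg_shift0/nbhs_dnbhs.
apply/is_derive_quotP; move/is_derive_quotP : cd => cd.
have E (x y : 'rV[R]_n) : dotv x x - dotv y y = dotv (x - y) (x + y).
  by rewrite dotvDl dotvNl !(dotvC _ (x + y)) !dotvDl (dotvC y x); ring.
under eq_cvg do rewrite E opprB addrA subrK -[_ *: _]/(_ * _) -dotvZl.
rewrite -dotvZr scaler_nat mulr2n; apply: cvg_dotv => //.
by apply: cvgD; [apply: cvgB => //; exact: cvg_cst|exact: cvg_cst].
Qed.

Lemma C2_C1 (R : realType) n k (f : 'rV[R]_n -> 'rV[R]_k) : C2 f -> C1 f.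
Proof.
move=> [df [dJ _]]; split=> // x.
have cJ : mxvec (Jac f y) @[y --> x] --> mxvec (Jac f x).
  exact: (differentiable_continuous (dJ x)).
apply: (@cvg_mx _ _ (nbhs x) (nbhs_filter (x : 'rV[R]_n))) => i j.
have := @cvg_coord _ _ (nbhs x) (nbhs_filter (x : 'rV[R]_n)) _ _ _ _
  0 (mxvec_index i j) cJ.
have -> : (fun y => mxvec (Jac f y) 0 (mxvec_index i j)) =
    (fun y => Jac f y i j).
  by apply/funext => y; rewrite mxvecE.
by rewrite mxvecE.
Qed.

(** Invariance concerns only [t >= 0], so [F] along the orbit is known to vanish only to the right
    of 0; the right difference quotient already determines the derivative. *)
Lemma invariant_velocity (R : realType) n k (f : 'rV[R]_n -> 'rV[R]_n)
    (D : 'rV[R]_n -> set R) (Phi : R -> 'rV[R]_n -> 'rV[R]_n)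
    (F : 'rV[R]_n -> 'rV[R]_k) p :
  flow_of f D Phi -> C1 F -> invariant_set D Phi (F @^-1` [set 0]) ->
  F p = 0 -> f p *m 'J F p = 0.
Proof.
move=> flow CF Minv Fp.
have [_ _ D0] := flow_dom flow p.
have := is_derive_curve (CF.1 _) (flow_sol flow D0).
rewrite /= (flow_init flow) => /is_derive_quot_right.
rewrite /= (flow_init flow) Fp => quot.
have quot0 : h^-1 *: (F (Phi (0 + h) p) - 0) @[h --> (0 : R)^'+] -->
    (0 : 'rV[R]_k).
  have : (0 : 'rV[R]_k) @[_ --> (0 : R)^'+] --> (0 : 'rV[R]_k).
    exact: cvg_cst.
  apply: cvg_trans; apply: near_eq_cvg; near=> h.
  have h0 : 0 <= h by apply: ltW; near: h; exact: nbhs_right_gt.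
  by have [_ /= FPhi] := Minv _ Fp _ h0; rewrite add0r FPhi subr0 scaler0.
exact: (cvg_unique _ quot quot0).
Unshelve. all: by end_near. Qed.

Lemma dotv_mulmx_sym (R : realType) n (J : 'M[R]_n) (v : 'rV[R]_n) :
  (v *m (J + J^T) *m v^T) 0 0 = 2 * dotv (v *m J) v.
Proof.
rewrite mulmxDr mulmxDl mxE -/(dotv _ _) -/(dotv (v *m J^T) v).
suff -> : dotv (v *m J^T) v = dotv (v *m J) v by ring.
by rewrite dotvC /dotv trmx_mul trmxK mulmxA.
Qed.

(** With [v = w *m Jac F p], the form of [Gamma] at [w] is that of [Jac f p] plus its transpose at
    [v], which is twice the stated product. *)
Lemma posdef_Gamma (R : realType) n k (f : 'rV[R]_n -> 'rV[R]_n)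
    (F : 'rV[R]_n -> 'rV[R]_k) p (w : 'rV[R]_k) :
  posdefmx (Gamma f F p) -> w != 0 ->
  0 < dotv (w *m Jac F p *m 'J f p) (w *m Jac F p).
Proof.
move=> [_ pos] /pos; rewrite /Gamma !mulmxA -(mulmxA _ (Jac F p)^T) -trmx_mul.
rewrite /Jac trmxK (addrC _ ('J f p)) dotv_mulmx_sym.
by rewrite pmulr_rgt0.
Qed.

(* Normal vectors at [p] are written [w *m Jac F p], which turns the claim into
   one about the compact unit sphere of the [w]'s, on a fixed space. *)
Lemma sphere_outward (R : realType) n k (f : 'rV[R]_n -> 'rV[R]_n)
    (F : 'rV[R]_n -> 'rV[R]_k) (M : set 'rV[R]_n) (p0 : 'rV[R]_n) :
  C1 f -> C1 F -> (forall p, M p -> f p *m 'J F p = 0) ->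
  posdefmx (Gamma f F p0) ->
  \forall z \near filter_prod (nbhs p0) ((0 : R)^'+),
    forall w : 'rV[R]_k, `|w| = 1 -> M z.1 -> forall s, 0 < s ->
    s ^+ 2 * dotv (w *m Jac F z.1) (w *m Jac F z.1) = z.2 ^+ 2 ->
    0 < dotv (f (z.1 + s *: (w *m Jac F z.1))) (w *m Jac F z.1).
Proof.
move=> Cf CF fM pos.
pose S := [set w : 'rV[R]_k | `|w| = 1].
have cS : compact S.
  apply: bounded_closed_compact.
    exists 1; split; first exact: num_real.
    by move=> r /ltW r1 w; rewrite /S/= => ->.
  apply: (@closed_comp _ _ (fun w : 'rV[R]_k => `|w|) [set r : R | r = 1]).
    by move=> w _; exact: norm_continuous.
  exact: closed_eq.
(* The equation on [s] says that the displacement [s *: (w *m Jac F z.1)] has Euclidean length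
   [z.2]. *)
pose P (z : 'rV[R]_n * R) (w : 'rV[R]_k) := M z.1 -> forall s, 0 < s ->
    s ^+ 2 * dotv (w *m Jac F z.1) (w *m Jac F z.1) = z.2 ^+ 2 ->
    0 < dotv (f (z.1 + s *: (w *m Jac F z.1))) (w *m Jac F z.1).
suff : \forall z \near filter_prod (nbhs p0) ((0 : R)^'+), S `<=` P z.
  by apply: filterS => z zS w w1; exact: zS.
have /compact_near_coveringP := cS; apply => w0 w01.
have w0n0 : w0 != 0 by rewrite -normr_eq0 w01 oner_eq0.
pose v0 := w0 *m Jac F p0.
have q0 : 0 < dotv (v0 *m 'J f p0) v0 by exact: posdef_Gamma.
have v0n0 : v0 != 0.
  by apply: contraTneq q0 => ->; rewrite /dotv trmx0 mulmx0 mxE ltxx.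
have a0 : 0 < dotv v0 v0 by rewrite dotvv_gt0.
set a := dotv v0 v0 in a0.
pose v (y : 'rV[R]_k * ('rV[R]_n * R)) := y.1 *m Jac F y.2.1.
(* The last variable stands for an intermediate point of the mean value theorem, independent of [e];
   it ranges over a full neighbourhood of 0. *)
pose G := filter_prod (nbhs w0) (filter_prod (nbhs p0) (nbhs (0 : R))).
have cw : y.1 @[y --> G] --> w0 by exact: cvg_fst.
have cp : y.2.1 @[y --> G] --> p0.
  by apply: (cvg_comp _ _ cvg_snd); exact: cvg_fst.
have cs : y.2.2 @[y --> G] --> (0 : R).
  by apply: (cvg_comp _ _ cvg_snd); exact: cvg_snd.
have cv : v y @[y --> G] --> v0.
  by apply: cvg_mulmx => //; exact: (cvg_comp _ _ cp (CF.2 p0)).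
have cps : y.2.1 + y.2.2 *: v y @[y --> G] --> p0.
  rewrite -[X in _ --> X]addr0 -(scale0r v0).
  by apply: cvgD => //; exact: cvgZ.
have cJ : 'J f (y.2.1 + y.2.2 *: v y) @[y --> G] --> 'J f p0.
  under eq_cvg do rewrite -(trmxK ('J f _)).
  rewrite -(trmxK ('J f p0)); apply: cvg_trmx.
  exact: (cvg_comp _ _ cps (Cf.2 p0)).
have cq : dotv (v y *m 'J f (y.2.1 + y.2.2 *: v y)) (v y) @[y --> G] -->
    dotv (v0 *m 'J f p0) v0.
  by apply: cvg_dotv => //; exact: cvg_mulmx.
have ca : dotv (v y) (v y) @[y --> G] --> a by exact: cvg_dotv.
have a2 : a / 2 < a by lra.
have near_q : \forall y \near G,
    0 < dotv (v y *m 'J f (y.2.1 + y.2.2 *: v y)) (v y) /\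
    a / 2 < dotv (v y) (v y).
  by apply: filterI; [exact: (cvgr_gt _ cq)|exact: (cvgr_gt _ ca)].
case: near_q => -[W Q] /= [nW [[U T] /= [nU nT] subQ]] sub.
have /nbhs_ballP[d /= d0 dT] := nT.
(* A lower bound for the Euclidean length of [w *m Jac F p] near the base point:
   [s * c <= e < d * c] then yields [s < d]. *)
pose c := Num.sqrt (a / 2).
have c0 : 0 < c by rewrite sqrtr_gt0 divr_gt0.
have c2 : c ^+ 2 = a / 2 by rewrite sqr_sqrtr// ltW// divr_gt0.
exists (W, U `*` [set e | 0 < e < d * c]) => /=.
  split=> //; exists (U, [set e | 0 < e < d * c]) => //=; split=> //.
  near=> e; apply/andP; split; near: e; first exact: nbhs_right_gt.
  by apply: nbhs_right_lt; rewrite mulr_gt0.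
move=> [w [p e]] /= [Ww [Up /andP[e0 edc]]]; rewrite /P/= => Mp s s0.
have qpos r : `|r| < d -> 0 < dotv (w *m Jac F p *m
      'J f (p + r *: (w *m Jac F p))) (w *m Jac F p) /\
    a / 2 < dotv (w *m Jac F p) (w *m Jac F p).
  move=> rd; apply: (sub (w, (p, r))); split=> //=.
  by apply: subQ; split=> //=; apply: dT; rewrite -ball_normE /= sub0r normrN.
set vp := w *m Jac F p in qpos *; move=> se.
have [_ avp] : 0 < dotv (vp *m 'J f (p + 0 *: vp)) vp /\ a / 2 < dotv vp vp.
  by apply: qpos; rewrite normr0.
have sd : s < d.
  rewrite -(ltr_pM2r c0) (le_lt_trans _ edc)//.
  rewrite -ler_sqr ?nnegrE ?mulr_ge0 ?ltW//.
  by rewrite -se exprMn c2 ltr_pM2l ?exprn_gt0.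
(* [phi] vanishes at 0 because [f p] is in the kernel of the Jacobian of [F], and its derivative is
   positive on []0, s[]. *)
pose phi (r : R) := dotv (f (p + r *: vp)) vp.
pose dphi (r : R) := dotv (vp *m 'J f (p + r *: vp)) vp.
have phid (r : R) : is_derive r 1 phi (dphi r).
  have df := Cf.1 (p + r *: vp).
  exact: (is_derive_dotv vp (is_derive_curve (c := fun r => p + r *: vp) df
    (is_derive_line p vp r))).
have [|r r0s] := @MVT R phi dphi 0 s s0 (fun r _ => phid r).
  apply: continuous_subspaceT => r; apply/differentiable_continuous.
  by apply/derivable1_diffP; case: (phid r).
have -> : phi 0 = 0.
  rewrite /phi scale0r addr0 /dotv /vp trmx_mul mulmxA /Jac trmxK fM//.
  by rewrite mul0mx mxE.
rewrite (subr0 (phi s)) (subr0 s) => phis.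
rewrite -[ltRHS]/(phi s) phis (pmulr_lgt0 _ s0).
move: r0s; rewrite in_itv/= => /andP[r0 rs].
by apply: (qpos r _).1; rewrite gtr0_norm// (lt_trans rs).
Unshelve. all: by end_near. Qed.

Section outward.
Variables (R : realType) (n k : nat) (f : 'rV[R]_n -> 'rV[R]_n).
Variables (F : 'rV[R]_n -> 'rV[R]_k).
Let M := F @^-1` [set 0].
Hypotheses (Cf : C1 f) (CF : C1 F).
Hypothesis rankF : forall p, M p -> \rank (Jac F p) = k.
Hypothesis fM : forall p, M p -> f p *m 'J F p = 0.

Lemma level_closed : closed M.
Proof.
apply: closed_comp => [x _|]; first exact: differentiable_continuous (CF.1 x).
exact: (accessible_closed_set1 (hausdorff_accessible (@norm_hausdorff R _))).
Qed.

(** A unit normal is [u = w *m Jac F p]. Rescaling [w] to norm 1 and taking [s = e * |w|] in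
    [sphere_outward] gives the same displacement [e *: u]. *)
Lemma outward_near (p0 : 'rV[R]_n) : posdefmx (Gamma f F p0) ->
  \forall z \near filter_prod (nbhs p0) ((0 : R)^'+),
    forall u, M z.1 -> unit_normal M z.1 u ->
    0 < dotv (f (z.1 + z.2 *: u)) u.
Proof.
move=> pos; have sph := sphere_outward Cf CF fM pos.
have pos2 : \forall z \near filter_prod (nbhs p0) ((0 : R)^'+), 0 < z.2.
  have e0 : \forall e \near (0 : R)^'+, 0 < e by exact: nbhs_right_gt.
  exact: (cvg_snd e0).
apply: filterS2 sph pos2 => -[p e] /= sph e0 u Mp [nu /enorm1E u1].
have [w uE] := normal_space_rows CF (rankF Mp) Mp nu.
have w0 : w != 0.
  apply/eqP => w0; move: u1; rewrite uE w0 mul0mx /dotv mul0mx mxE => /eqP.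
  by rewrite eq_sym oner_eq0.
have nw0 : 0 < `|w| by rewrite normr_gt0.
have w'A : (`|w|^-1 *: w) *m Jac F p = `|w|^-1 *: u by rewrite -scalemxAl -uE.
have := sph (`|w|^-1 *: w) _ Mp (e * `|w|) (mulr_gt0 e0 nw0).
rewrite w'A dotvZl !dotvZr u1 scalerA mulfK ?gt_eqF// mulr1.
rewrite pmulr_rgt0 ?invr_gt0//; apply.
  by rewrite normrZ ger0_norm ?invr_ge0// mulVf// gt_eqF.
by rewrite exprMn -mulrA -expr2 -exprMn mulfV ?expr1n ?mulr1// gt_eqF.
Qed.

Variable Omega : set 'rV[R]_n.
Hypothesis Gpos : forall p, (M `&` Omega) p -> posdefmx (Gamma f F p).

Lemma outward_on : compact (M `&` Omega) ->
  \forall e \near (0 : R)^'+, tube_overflowing f M e Omega.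
Proof.
move=> /compact_near_coveringP/(_ _ ((0 : R)^'+) (fun e p => forall u, M p ->
  unit_normal M p u -> 0 < dotv (f (p + e *: u)) u) _) cov.
have : \forall e \near (0 : R)^'+, M `&` Omega `<=` (fun p => forall u, M p ->
    unit_normal M p u -> 0 < dotv (f (p + e *: u)) u).
  apply: cov => p MOp; exact: outward_near (Gpos MOp).
by apply: filterS => e sub p u MOp; apply: sub => //; exact: MOp.1.
Qed.

(* The foot point [p] need not lie in [Omega], but for small [e] it is close to
   a point of [M `&` Omega]. *)
Lemma outward_from : compact Omega ->
  \forall e \near (0 : R)^'+, forall p u, Omega (p + e *: u) -> M p ->
    unit_normal M p u -> 0 < dotv (f (p + e *: u)) u.
Proof.
move=> /compact_near_coveringP/(_ _ ((0 : R)^'+) (fun e y => forall p u,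
  y = p + e *: u -> M p -> unit_normal M p u -> 0 < dotv (f y) u) _) cov.
have : \forall e \near (0 : R)^'+, Omega `<=` (fun y => forall p u,
    y = p + e *: u -> M p -> unit_normal M p u -> 0 < dotv (f y) u).
  apply: cov => y0 Oy0.
  have : \forall z \near filter_prod (nbhs y0) ((0 : R)^'+),
      forall u, M z.1 -> unit_normal M z.1 u -> 0 < dotv (f (z.1 + z.2 *: u)) u.
    (* Off [M] the claim is vacuous near [y0], because [M] is closed. *)
    have [My0|My0] := pselect (M y0); first exact: outward_near (Gpos _).
    have nMy0 : \forall p \near y0, ~ M p.
      by apply: open_nbhs_nbhs; split => //; exact: closed_openC level_closed.
    have : \forall z \near filter_prod (nbhs y0) ((0 : R)^'+), ~ M z.1.
      exact: (cvg_fst nMy0).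
    by apply: filterS => z nMz u /nMz.
  move=> [[U E] /= [nU nE] sub].
  have /nbhs_ballP[d /= d0 dU] := nU.
  have d2 : 0 < d / 2 by rewrite divr_gt0.
  (* The foot point satisfies [|y0 - p| <= |y0 - y| + e * |u|] with [|u| <= 1] in the sup norm, so
     half of [d] is granted to each term. *)
  exists (ball y0 (d / 2), E `&` [set e | 0 < e < d / 2]) => /=.
    split; first exact: nbhsx_ballx.
    apply: filterI => //; near=> e; apply/andP; split; near: e.
      exact: nbhs_right_gt.
    exact: nbhs_right_lt.
  move=> [y e] /= [y0y [Ee /andP[e0 ed]]] p u yE Mp pu.
  rewrite yE; apply: (sub (p, e)) => //=; split => //; apply: dU.
  have u1 : `|u| <= 1.
    rewrite -(@ler_pXn2r _ 2)// ?nnegrE// expr1n.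
    by rewrite (le_trans (sqr_norm_le_dotv u))// (enorm1E pu.2).
  move: y0y; rewrite -!ball_normE /= => y0y.
  have -> : y0 - p = (y0 - y) + e *: u by rewrite yE opprD addrA subrK.
  rewrite (le_lt_trans (ler_normD _ _))// [ltRHS]splitr ltrD//.
  by rewrite normrZ gtr0_norm// (le_lt_trans _ ed)// ler_piMr// ltW.
by apply: filterS => e sub p u Op; exact: sub.
Unshelve. all: by end_near. Qed.

End outward.

(** * The closed tube as a distance neighbourhood *)

Section nearest.
Variables (R : realType) (n : nat) (M : set 'rV[R]_n).
Hypothesis Mcl : closed M.

Let sqdist (y p : 'rV[R]_n) := dotv (y - p) (y - p).

Let sqdistC y p : sqdist y p = sqdist p y.
Proof. by rewrite /sqdist -opprB dotvNl dotvC dotvNl opprK. Qed.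

Let sqdist_lb (y p : 'rV[R]_n) (r : R) :
  0 <= r -> r < `|y - p| -> r ^+ 2 < sqdist y p.
Proof.
move=> r0 ryp; apply: lt_le_trans (sqr_norm_le_dotv _).
by rewrite ltr_pXn2r// nnegrE.
Qed.

Lemma compact_setI_closed_ball (y : 'rV[R]_n) (r : R) :
  compact (M `&` closed_ball_ Num.norm y r).
Proof.
apply: bounded_closed_compact; last first.
  by apply: closedI => //; exact: closed_closed_ball_.
exists (`|y| + r); split; first exact: num_real.
move=> s rs p [_]; rewrite /closed_ball_/= => yp; rewrite (le_trans _ (ltW rs))//.
by rewrite -(subrK y p) addrC (le_trans (ler_normD _ _))// lerD// distrC.
Qed.

(** The minimum is taken over the part of [M] in a sup-norm ball whose radius is the Euclidean
    distance to some [p1] in [M]; points outside that ball are farther away than [p1]. *)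
Lemma nearest_point (y : 'rV[R]_n) : M !=set0 ->
  exists2 p, M p &
    forall q, M q -> dotv (y - p) (y - p) <= dotv (y - q) (y - q).
Proof.
move=> [p1 Mp1]; pose r := Num.sqrt (sqdist y p1).
have r2 : r ^+ 2 = sqdist y p1 by rewrite sqr_sqrtr// dotvv_ge0.
have csq : continuous (sqdist y).
  move=> p; have cyp : y - q @[q --> p] --> y - p.
    apply: (@cvgB _ _ _ _ (nbhs_filter (p : 'rV[R]_n))); first exact: cvg_cst.
    exact: cvg_id.
  exact: (@cvg_dotv _ _ (nbhs p) (nbhs_filter (p : 'rV[R]_n))
    _ _ _ _ _ cyp cyp).
have Kp1 : (M `&` closed_ball_ Num.norm y r) p1.
  split => //; rewrite /closed_ball_/= leNgt; apply/negP.
  by move/sqdist_lb; rewrite sqrtr_ge0 r2 ltxx => /(_ isT).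
have [|p] := @EVT_min_rV R n (sqdist y) _ _ (@compact_setI_closed_ball y r)
    (continuous_subspaceT csq); first by exists p1.
rewrite inE => -[Mp _] pmin; exists p => // q Mq.
have [yq|yq] := leP `|y - q| r; first by apply: pmin; rewrite inE.
apply: (le_trans (pmin p1 _)); first by rewrite inE.
by rewrite -r2 ltW// sqdist_lb// sqrtr_ge0.
Qed.

(** Along a curve in [M] through [p] the squared distance to [y] is minimal at [p], so its
    derivative there vanishes. *)
Lemma nearest_normal (y p : 'rV[R]_n) : M p ->
  (forall q, M q -> dotv (y - p) (y - p) <= dotv (y - q) (y - q)) ->
  Defs.normal_space M p (y - p).
Proof.
move=> Mp pmin v [c [c0 cM cv]].
have := is_derive_min (is_derive_sqdist y cv); rewrite c0 => dmin.
have : 2 * dotv v (p - y) = 0.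
  apply: dmin; near=> h.
  rewrite -!/(sqdist _ _) !(sqdistC _ y); apply: pmin.
  by rewrite add0r; near: h.
move/eqP; rewrite mulf_eq0 pnatr_eq0/= => /eqP vpy.
by rewrite dotvC -opprB dotvC dotvNl dotvC vpy oppr0.
Unshelve. all: by end_near. Qed.

Lemma nearest_unit_normal (y p : 'rV[R]_n) (e : R) : 0 < e -> M p ->
  (forall q, M q -> dotv (y - p) (y - p) <= dotv (y - q) (y - q)) ->
  dotv (y - p) (y - p) = e ^+ 2 -> unit_normal M p (e^-1 *: (y - p)).
Proof.
move=> e0 Mp pmin ype; split.
  by move=> v pv; rewrite dotvZl (nearest_normal Mp pmin pv) mulr0.
rewrite /enorm dotvZl dotvZr ype mulrA -expr2 -exprMn mulVf ?gt_eqF//.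
by rewrite expr1n sqrtr1.
Qed.

(** For the converse, [p1] is replaced by a nearest point [p], so that [y - p] is normal. Its length
    [d] being zero, equal to [e] or in between selects [M], the boundary or the open tube. *)
Lemma closed_tubeP (e : R) (y : 'rV[R]_n) : 0 < e -> closed_tube M e y <->
  exists2 p, M p & dotv (y - p) (y - p) <= e ^+ 2.
Proof.
move=> e0; split.
- move=> [[My|[p [u [d [Mp pu /andP[d0 de] ->]]]]]|[p [u [Mp pu ->]]]].
  + by exists y => //; rewrite subrr /dotv mul0mx mxE sqr_ge0.
  + exists p => //; rewrite addrAC subrr add0r dotvZl dotvZr (enorm1E pu.2).
    by rewrite mulr1 -expr2 ler_sqr ?nnegrE ltW.
  + exists p => //; rewrite addrAC subrr add0r dotvZl dotvZr (enorm1E pu.2).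
    by rewrite mulr1 -expr2.
move=> [p1 Mp1 yp1].
have [|p Mp pmin] := nearest_point y; first by exists p1.
have [->|yp] := eqVneq y p; first by left; left.
pose d := enorm (y - p).
have d0 : 0 < d by rewrite /d /enorm sqrtr_gt0 dotvv_gt0 subr_eq0.
have d2 : dotv (y - p) (y - p) = d ^+ 2 by rewrite sqr_sqrtr// dotvv_ge0.
have pu := nearest_unit_normal d0 Mp pmin d2.
have yE : y = p + d *: (d^-1 *: (y - p)).
  by rewrite scalerA mulfV ?gt_eqF// scale1r addrC subrK.
have : d <= e.
  by rewrite -ler_sqr ?nnegrE ?(ltW d0) ?(ltW e0)// -d2 (le_trans (pmin _ Mp1)).
rewrite le_eqVlt => /orP[/eqP de|de].
  by right; exists p, (d^-1 *: (y - p)); split => //; rewrite -de.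
by left; right; exists p, (d^-1 *: (y - p)), d; split => //; rewrite d0 de.
Qed.

(** The complement is open: compactness makes the strict inequality stable in [y] for all points of
    [M] in the ball of radius [e + 1], and points of [M] outside it remain farther than [e] from any
    [y'] within 1 of [y]. *)
Lemma closed_tube_closed (e : R) : 0 < e -> closed (closed_tube M e).
Proof.
move=> e0; rewrite -[X in closed X]setCK; apply: open_closedC.
rewrite openE => y /= ny; rewrite /interior.
have e2 : 0 <= e + 1 by lra.
have /compact_near_coveringP := @compact_setI_closed_ball y (e + 1).
move=> /(_ _ (nbhs y) (fun y' p => M p -> e ^+ 2 < sqdist y' p) _) cov.
have near1 : \forall y' \near y, M `&` closed_ball_ Num.norm y (e + 1) `<=`
    (fun p => M p -> e ^+ 2 < sqdist y' p).
  apply: cov => p [Mp _].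
  have yp : e ^+ 2 < sqdist y p.
    rewrite ltNge; apply/negP => yp; apply: ny; apply/closed_tubeP => //.
    by exists p.
  have csq : sqdist z.2 z.1 @[z --> filter_prod (nbhs p) (nbhs y)] -->
      sqdist y p.
    by apply: cvg_dotv; apply: cvgB; (exact: cvg_snd || exact: cvg_fst).
  have : \forall z \near filter_prod (nbhs p) (nbhs y), e ^+ 2 < sqdist z.2 z.1.
    exact: (cvgr_gt _ csq).
  by apply: filterS.
have near2 : \forall y' \near y, `|y - y'| < 1.
  by have := nbhsx_ballx (y : 'rV[R]_n) (1 : R) ltr01; rewrite -ball_normE.
apply: filterS2 near1 near2 => y' sub yy' /closed_tubeP[//|p Mp]; apply/negP.
rewrite -ltNge -/(sqdist _ _).
have [yp|yp] := leP `|y - p| (e + 1); first exact: sub.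
apply: sqdist_lb; first exact: ltW.
have := ler_normD (y - y') (y' - p); rewrite addrA subrK; lra.
Qed.

End nearest.

(* At a first entrance time [t1] into the closed tube the orbit is at distance
   exactly [eps] from a nearest point [p] of [M]; since the velocity points
   outwards there, the orbit was even closer to [p] just before [t1]. *)
Lemma closed_tube_no_entrance (R : realType) n (f : 'rV[R]_n -> 'rV[R]_n)
    (D : 'rV[R]_n -> set R) (Phi : R -> 'rV[R]_n -> 'rV[R]_n)
    (M Omega : set 'rV[R]_n) (e : R) :
  flow_of f D Phi -> closed M -> invariant_set D Phi Omega -> 0 < e ->
  (forall p u, Omega (p + e *: u) -> M p -> unit_normal M p u ->
    0 < dotv (f (p + e *: u)) u) ->
  invariant_set D Phi (Omega `\` closed_tube M e).
Proof.
move=> flow Mcl Oinv e0 out x [Ox xT] t t0.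
have [Dt Ot] := Oinv _ Ox _ t0; split => //; split => // tT.
pose S := [set s | [/\ 0 <= s, s <= t & closed_tube M e (Phi s x)]].
have St : S t by split.
have infS : has_inf S.
  by split; [exists t|exists 0 => s []].
pose t1 := inf S.
have t1_ge0 : 0 <= t1 by apply: lb_le_inf => [|s []//]; exists t.
have [D1 O1] := Oinv _ Ox _ t1_ge0.
have dPhi := flow_sol flow D1.
have cPhi : Phi s x @[s --> t1] --> Phi t1 x.
  by apply/differentiable_continuous/derivable1_diffP; case: dPhi.
(* The infimum is attained: [S] has elements arbitrarily close to [t1], and the tube is closed. *)
have T1 : closed_tube M e (Phi t1 x).
  apply: contrapT => nT1.
  have nT : \forall y \near Phi t1 x, ~ closed_tube M e y.
    apply: open_nbhs_nbhs; split => //.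
    exact: closed_openC (closed_tube_closed Mcl e0).
  have /nbhs_ballP[d /= d0 dT] := cPhi _ nT.
  have [s Ss st1] := inf_adherent d0 infS.
  have t1s : t1 <= s by exact: ge_inf infS.2 _ Ss.
  case: Ss => _ _; apply: dT; rewrite -ball_normE /= distrC.
  rewrite ger0_norm ?subr_ge0//; rewrite -/t1 in st1; lra.
have t1_gt0 : 0 < t1.
  rewrite lt_neqAle t1_ge0 andbT; apply/eqP => t10.
  by apply: xT; rewrite -(flow_init flow x) t10.
have before s : 0 <= s -> s < t1 -> ~ closed_tube M e (Phi s x).
  move=> s0 st1 sT; have : t1 <= s; last by rewrite leNgt st1.
  apply: ge_inf infS.2 _ _; split => //.
  by rewrite (le_trans (ltW st1))//; exact: ge_inf infS.2 _ St.
(* Such proximity would put the orbit in the closed tube before [t1]; [h] is also taken above [- t1]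
   to keep the time nonnegative. *)
have far p : M p -> ~ \forall h \near (0 : R)^'-,
    dotv (Phi (t1 + h) x - p) (Phi (t1 + h) x - p) < e ^+ 2.
  move=> Mp nearp; have nt1 : - t1 < 0 by rewrite oppr_lt0.
  have [h /= [[hp h0] ht1]] : exists h : R,
      (dotv (Phi (t1 + h) x - p) (Phi (t1 + h) x - p) < e ^+ 2 /\ h < 0) /\
      - t1 < h.
    apply: (@filter_ex _ (0 : R)^'-); apply: filterI; last exact: nbhs_left_gt.
    by apply: filterI => //; exact: nbhs_left_lt.
  apply: (before (t1 + h)); [lra|lra|].
  by apply/(closed_tubeP Mcl _ e0); exists p => //; exact: ltW.
have [p Mp pe] := (closed_tubeP Mcl (Phi t1 x) e0).1 T1.
(* By continuity a distance below [e] at [t1] would persist just before, against [far]. Hence [p] is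
   a nearest point, at distance exactly [e]. *)
have ge_e q : M q -> e ^+ 2 <= dotv (Phi t1 x - q) (Phi t1 x - q).
  move=> Mq; rewrite leNgt; apply/negP => lt_e; apply: (far q Mq).
  have csq : {for t1, continuous (fun s => dotv (Phi s x - q) (Phi s x - q))}.
    apply/differentiable_continuous/derivable1_diffP.
    by case: (is_derive_sqdist q dPhi).
  have : \forall s \near t1, dotv (Phi s x - q) (Phi s x - q) < e ^+ 2.
    exact: (cvgr_lt _ csq).
  by move/(cvg_at_left_filter (@cvg_shift0 R t1)).
have pE : dotv (Phi t1 x - p) (Phi t1 x - p) = e ^+ 2.
  by apply/eqP; rewrite eq_le pe ge_e.
have pu : unit_normal M p (e^-1 *: (Phi t1 x - p)).
  by apply: nearest_unit_normal => // q Mq; rewrite pE ge_e.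
have yE : p + e *: (e^-1 *: (Phi t1 x - p)) = Phi t1 x.
  by rewrite scalerA mulfV ?gt_eqF// scale1r addrC subrK.
(* The squared distance to [p] has derivative twice the product of the velocity with [Phi t1 x - p],
   positive by [out], so it is smaller just before [t1]. *)
apply: (far p Mp); rewrite -pE.
apply: is_derive_gt0_left (is_derive_sqdist p dPhi) _.
have := out _ _ _ Mp pu; rewrite yE => /(_ O1).
by rewrite dotvZr pmulr_rgt0 ?invr_gt0// => ?; rewrite mulr_gt0.
Qed.

Theorem mainTheorem2 (R : realType) (n m : nat) (hmn : (m <= n)%N)
  (f : 'rV[R]_n -> 'rV[R]_n)
  (D : 'rV[R]_n -> set R) (Phi : R -> 'rV[R]_n -> 'rV[R]_n)
  (F : 'rV[R]_n -> 'rV[R]_(n - m)) (M Omega : set 'rV[R]_n)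
  (f_C2 : C2 f) (f_flow : flow_of f D Phi)
  (F_C1 : C1 F) (M_def : M = F @^-1` [set 0])
  (F_rank : forall p, M p -> \rank (Jac F p) = (n - m)%N)
  (M_inv : invariant_set D Phi M)
  (Omega_compact : compact Omega)
  (MOmega_compact : compact (M `&` Omega))
  (MOmega_neq0 : M `&` Omega !=set0)
  (Gamma_pos : forall p, (M `&` Omega) p -> posdefmx (Gamma f F p))
  (Omega_inv : invariant_set D Phi Omega)
  (Omega_proper : M `&` Omega `<` Omega) :
  exists eps_star : R, 0 < eps_star /\
    forall eps : R, 0 < eps <= eps_star ->
      tube_overflowing f M eps Omega /\
      invariant_set D Phi (Omega `\` closed_tube M eps).
Proof.
subst M; have f_C1 := C2_C1 f_C2.
have fM p : F p = 0 -> f p *m 'J F p = 0.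
  exact: invariant_velocity f_flow F_C1 M_inv.
have on_tube := outward_on f_C1 F_C1 F_rank fM Gamma_pos MOmega_compact.
have from_Omega := outward_from f_C1 F_C1 F_rank fM Gamma_pos Omega_compact.
have [d /= d0 small] := filterI on_tube from_Omega.
(* Halving keeps the endpoint [eps = eps_star] inside the open ball of radius [d]. *)
exists (d / 2); split; first by rewrite divr_gt0.
move=> eps /andP[eps0 epsd].
have [|//|tube_eps Omega_eps] := small eps.
  by rewrite /= sub0r normrN gtr0_norm//; lra.
split => //; apply: (closed_tube_no_entrance f_flow) => //.
exact: level_closed.
Qed.
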